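(* Let $(\mathscr{X},\varphi,\odot)$ be a probabilistic normed space, and let $\alpha(n)$ and $\vartheta(n)$ be sequences of non-negative integers with $\alpha(n)<\vartheta(n)$ for all $n$ and $\lim_{n\to\infty}\vartheta(n)=\infty$. Let $\{w_k\}_{k\in\mathbb{N}}$ be a sequence in $\mathscr{X}$ and $\xi\in\mathscr{X}$. If $w_k\xrightarrow{\varphi}\xi$ (convergence with respect to the probabilistic norm $\varphi$), then $w_k\xrightarrow{\mathscr{D}_\alpha^\vartheta(\mathcal{S}^\varphi)}\xi$ (deferred statistical convergence with respect to $\varphi$).
   Context: Here $\mathbb{N}=\{1,2,\dots\}$ and $\mathbb{R}_0^+=[0,\infty)$. A continuous $t$-norm is a binary operation $\odot:[0,1]\times[0,1]\to[0,1]$ that is associative, commutative, continuous, satisfies $a\odot 1=a$ for all $a\in[0,1]$, and satisfies $a\odot b\le c\odot d$ whenever $a\le c$ and $b\le d$. A distribution function is a non-decreasing, left-continuous function $\mathscr{G}:\mathbb{R}\to\mathbb{R}_0^+$ with $\inf_{t}\mathscr{G}(t)=0$ and $\sup_t\mathscr{G}(t)=1$; $\Delta$ is the set of all distribution functions. A probabilistic normed space (PNS) is a triple $(\mathscr{X},\varphi,\odot)$ where $\mathscr{X}$ is a real vector space, $\odot$ is a continuous $t$-norm, and $\varphi:\mathscr{X}\to\Delta$ (writing $\varphi(\tau;\varepsilon)$ for the value of $\varphi(\tau)$ at $\varepsilon\in\mathbb{R}$) satisfies: (1) $\varphi(\tau;0)=0$ for all $\tau$; (2) $\varphi(\tau;\varepsilon)=1$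 for all $\varepsilon>0$ if and only if $\tau$ is the zero vector; (3) $\varphi(\kappa\tau;\varepsilon)=\varphi(\tau;\varepsilon/|\kappa|)$ for all $\kappa\in\mathbb{R}\setminus\{0\}$, $\varepsilon>0$; (4) $\varphi(\tau+\zeta;\varepsilon+\lambda)\ge\varphi(\tau;\varepsilon)\odot\varphi(\zeta;\lambda)$ for all $\tau,\zeta\in\mathscr{X}$ and $\varepsilon,\lambda\in\mathbb{R}_0^+$. Convergence with respect to $\varphi$: $w_k\xrightarrow{\varphi}\xi$ means that for every $\varepsilon>0$ and $\sigma\in(0,1)$ there is a positive integer $n_0$ with $\varphi(w_k-\xi;\varepsilon)>1-\sigma$ for all $k\ge n_0$. Deferred statistical convergence with respect to $\varphi$: $w_k\xrightarrow{\mathscr{D}_\alpha^\vartheta(\mathcal{S}^\varphi)}\xi$ means that for every $\varepsilon>0$ and $\sigma\in(0,1)$, $$\lim_{n\to\infty}\frac{1}{\vartheta(n)-\alpha(n)}\left|\{k\in\mathbb{N}:\alpha(n)+1\le k\le\vartheta(n),\ \varphi(w_k-\xi;\varepsilon)\le 1-\sigma\}\right|=0.$$ *)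

(* Defs.v *)
From HB Require Import structures.
From mathcomp Require Import all_boot all_order all_algebra.
From mathcomp Require Import all_classical all_reals all_analysis.

Set Implicit Arguments.
Unset Strict Implicit.
Unset Printing Implicit Defensive.

Import Order.TTheory GRing.Theory Num.Theory.
Import numFieldNormedType.Exports.

Local Open Scope classical_set_scope.
Local Open Scope ring_scope.

(* An operation on [0, 1] is represented by a function on R, of which only the
   values on [0, 1] x [0, 1] are constrained or used. *)
Record continuous_tnorm (R : realType) (op : R -> R -> R) : Prop := {
  tnorm_closed : forall a b : R, a \in `[0, 1] -> b \in `[0, 1] ->
    op a b \in `[0, 1];
  tnorm_assoc : forall a b c : R,
    a \in `[0, 1] -> b \in `[0, 1] -> c \in `[0, 1] ->
    op a (op b c) = op (op a b) c;
  tnorm_comm : forall a b : R, a \in `[0, 1] -> b \in `[0, 1] ->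
    op a b = op b a;
  tnorm_continuous :
    {within `[0, 1] `*` `[0, 1], continuous (fun p : R * R => op p.1 p.2)};
  tnorm_one : forall a : R, a \in `[0, 1] -> op a 1 = a;
  tnorm_mono : forall a b c d : R,
    a \in `[0, 1] -> b \in `[0, 1] -> c \in `[0, 1] -> d \in `[0, 1] ->
    a <= c -> b <= d -> op a b <= op c d
}.

(* [inf] and [sup] default to 0 on sets without a bound. Here the range is
   bounded below by [distr_ge0], and [sup = 1] forces it to be bounded above. *)
Record distribution_function (R : realType) (G : R -> R) : Prop := {
  distr_ge0 : forall t, 0 <= G t;
  distr_nondecreasing : {homo G : s t / s <= t};
  distr_left_continuous : forall t, G x @[x --> t^'-] --> G t;
  distr_inf : inf (range G) = 0;
  distr_sup : sup (range G) = 1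
}.

Record probabilistic_normed_space (R : realType) (X : lmodType R)
    (phi : X -> R -> R) (op : R -> R -> R) : Prop := {
  pns_tnorm : continuous_tnorm op;
  pns_distribution : forall tau, distribution_function (phi tau);
  pns_at0 : forall tau, phi tau 0 = 0;
  pns_eq1 : forall tau, (forall e : R, 0 < e -> phi tau e = 1) <-> tau = 0;
  pns_scale : forall tau (kappa e : R), kappa != 0 -> 0 < e ->
    phi (kappa *: tau) e = phi tau (e / `|kappa|);
  pns_triangle : forall tau zeta (e l : R), 0 <= e -> 0 <= l ->
    op (phi tau e) (phi zeta l) <= phi (tau + zeta) (e + l)
}.

(* Sequences indexed by {1, 2, ...} are functions on [nat] whose value at 0 is
   never used. *)
Definition pn_converges (R : realType) (X : lmodType R) (phi : X -> R -> R)
    (w : nat -> X) (xi : X) : Prop :=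
  forall e s : R, 0 < e -> 0 < s < 1 ->
    exists n0 : nat, (0 < n0)%N /\
      forall k : nat, (n0 <= k)%N -> 1 - s < phi (w k - xi) e.

Definition deferred_count (R : realType) (X : lmodType R) (phi : X -> R -> R)
    (w : nat -> X) (xi : X) (alpha theta : nat -> nat) (e s : R) (n : nat) :
    nat :=
  #|[pred k : 'I_(theta n).+1 |
      (alpha n + 1 <= k)%N && (phi (w k - xi) e <= 1 - s)]|.

Definition deferred_stat_converges (R : realType) (X : lmodType R)
    (phi : X -> R -> R) (alpha theta : nat -> nat) (w : nat -> X) (xi : X) :
    Prop :=
  forall e s : R, 0 < e -> 0 < s < 1 ->
    ((theta n)%:R - (alpha n)%:R)^-1
      * (deferred_count phi w xi alpha theta e s n)%:R @[n --> \oo] --> (0 : R).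

(* Main.v *)
(** Only indices [k < n0] can be bad, so at most [n0 - alpha n] (truncated) bad
    indices lie above [alpha n], and [(n0 - alpha n) / (theta n - alpha n)] is
    at most [n0 / theta n] as soon as [n0 <= theta n].  In particular
    [theta n - alpha n] need not tend to infinity. *)
Require Import Defs.
From HB Require Import structures.
From mathcomp Require Import all_boot all_order all_algebra.
From mathcomp Require Import all_classical all_reals all_analysis.
From mathcomp Require Import zify.
Import Order.TTheory GRing.Theory Num.Theory.
Import numFieldNormedType.Exports.
Local Open Scope classical_set_scope.
Local Open Scope ring_scope.

(** The values of the members of [P] form a duplicate-free list inside [a+1, ..., b]. Admitting [b]
    costs one unit but makes the bound exactly the truncated [b - a]; for [b <= a] both sides
    vanish. *)
Lemma card_ord_between_le (m a b : nat) (P : pred 'I_m) :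
  (forall k, P k -> (a < k < b)%N) -> (#|P| <= b - a)%N.
Proof.
move=> Pab; rewrite cardE -(size_map val) -(size_iota a.+1 (b - a)).
apply: uniq_leq_size; first by rewrite (map_inj_uniq val_inj) enum_uniq.
move=> _ /mapP[k + ->]; rewrite mem_enum mem_iota => /Pab.
by move=> /=; lia.
Qed.

Lemma deferred_count_le (R : realType) (X : lmodType R) (phi : X -> R -> R)
    (w : nat -> X) (xi : X) (alpha theta : nat -> nat) (e s : R) (n0 n : nat) :
  (forall k, (n0 <= k)%N -> 1 - s < phi (w k - xi) e) ->
  (deferred_count phi w xi alpha theta e s n <= n0 - alpha n)%N.
Proof.
move=> good; apply: card_ord_between_le => k /= /andP[ak bad].
rewrite -addn1 ak ltnNge; apply/negP => /good.
by rewrite ltNge bad.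
Qed.

Lemma truncated_ratio_le (R : realType) (m a t : nat) :
  (a < t)%N -> (m <= t)%N ->
  (t%:R - a%:R)^-1 * (m - a)%N%:R <= m%:R * t%:R^-1 :> R.
Proof.
move=> at_ mt; rewrite -natrB; last exact: ltnW.
rewrite mulrC ler_pdivrMr ?ltr0n ?subn_gt0//.
rewrite mulrAC ler_pdivlMr ?ltr0n; last exact: leq_ltn_trans at_.
(* Cross-multiplied: [(m - a) * t <= m * (t - a)]. The left side is 0 if [m <= a]; otherwise this
   amounts to [a * m <= a * t]. *)
by rewrite -!natrM ler_nat; nia.
Qed.

Theorem theorem3p3 (R : realType) (X : lmodType R) (phi : X -> R -> R)
    (op : R -> R -> R) (hX : probabilistic_normed_space phi op)
    (alpha theta : nat -> nat)
    (halt : forall n : nat, (0 < n)%N -> (alpha n < theta n)%N)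
    (htheta : theta n @[n --> \oo] --> \oo)
    (w : nat -> X) (xi : X) :
  pn_converges phi w xi -> deferred_stat_converges phi alpha theta w xi.
Proof.
move=> cvw e s e0 s01; have [n0 [_ good]] := cvw e s e0 s01.
(* The sequences start at index 1, so [halt] says nothing at [n = 0]. *)
have n_gt0 : \forall n \near \oo, (0 < n)%N by exact: nbhs_infty_gt.
have theta_ge : \forall n \near \oo, (n0 <= theta n)%N.
  exact: htheta (nbhs_infty_ge n0).
have bound0 : n0%:R * (theta n)%:R^-1 @[n --> \oo] --> (0 : R).
  rewrite -[X in _ --> X](mulr0 n0%:R); apply: cvgMl_tmp.
  (* Inverses tend to 0 when the terms tend to infinity and are eventually positive; positivity
     comes from [alpha n < theta n]. *)
  rewrite gtr0_cvgV0; first exact/cvgrnyP.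
  by near=> n; rewrite ltr0n (leq_ltn_trans _ (halt n _))//; near: n.
apply: (squeeze_cvgr _ (cvg_cst 0) bound0).
near=> n.
have an : (alpha n < theta n)%N by apply: halt; near: n.
have c0 : 0 <= ((theta n)%:R - (alpha n)%:R)^-1 :> R.
  by rewrite invr_ge0 subr_ge0 ler_nat ltnW.
rewrite mulr_ge0//=; apply: (le_trans _ (truncated_ratio_le R n0 _ _ an _)).
  by rewrite ler_wpM2l// ler_nat deferred_count_le.
by near: n.
Unshelve. all: by end_near.
Qed.
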